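(* Let $R$ be an arbitrary (commutative) valuation ring with an involution $\sigma$, and let $u\in R$ be such that $u^\sigma u=1$. Suppose that there exists $r\in R$ with $r+r^\sigma u\in R^\times$ (e.g. if $1+u\in R^\times$). Then not-necessarily-unimodular $u$-hermitian forms over $(R,\sigma)$ cancel from orthogonal sums: if $(P,h)$, $(Q,g)$, $(Q',g')$ are $u$-hermitian spaces over $(R,\sigma)$ (none of them assumed unimodular) and $(P,h)\perp(Q,g)\cong(P,h)\perp(Q',g')$, then $(Q,g)\cong(Q',g')$.
   Context: An involution of the commutative ring $R$ is a ring automorphism $\sigma$ with $\sigma^2=\mathrm{id}_R$ (possibly $\sigma=\mathrm{id}_R$). A $u$-hermitian space over $(R,\sigma)$ is a pair $(P,h)$ with $P$ a finitely generated projective $R$-module and $h:P\times P\to R$ biadditive with $h(xa,yb)=a^\sigma h(x,y)b$ and $h(x,y)=h(y,x)^\sigma u$ for all $x,y\in P$, $a,b\in R$. An isometry $(P,h)\to(P',h')$ is an $R$-isomorphism $\psi$ with $h'(\psi x,\psi y)=h(x,y)$; $\cong$ means that an isometry exists. The orthogonal sum is $(P\oplus Q,h\perp g)$ with $(h\perp g)(x\oplus y,x'\oplus y')=h(x,x')+g(y,y')$. Unimodular means that $x\mapsto h(x,\cdot)$ is an isomorphism $P\to\mathrm{Hom}_R(P,R)$. *)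

(* Defs.v *)
From HB Require Import structures.
From mathcomp Require Import all_boot all_algebra.

Set Implicit Arguments.
Unset Strict Implicit.
Unset Printing Implicit Defensive.

Import GRing.Theory.
Local Open Scope ring_scope.

(* Fields are (trivial) valuation rings. *)
Definition valuation_ring (R : idomainType) : Prop :=
  forall a b : R, (exists c, b = c * a) \/ (exists c, a = c * b).

Definition finitely_generated (R : comNzRingType) (P : lmodType R) : Prop :=
  exists (n : nat) (e : 'I_n -> P),
    forall x : P, exists a : 'I_n -> R, x = \sum_(i < n) a i *: e i.

Definition projective (R : comNzRingType) (P : lmodType R) : Prop :=
  forall (M N : lmodType R) (p : {linear M -> N}) (f : {linear P -> N}),
    (forall y : N, exists x : M, p x = y) ->
    exists g : {linear P -> M}, forall x : P, p (g x) = f x.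

(* R is commutative, so right R-modules are represented as lmodType's, x a     *)
(* being written a *: x.  The bilinear structure of the form says that it is   *)
(* biadditive with h (a *: x) y = sigma a * h x y and h x (b *: y) = b * h x y.*)
(* Unimodularity is not required.                                              *)
Record herm_space (R : comNzRingType) (sigma : involutive_rmorphism R) (u : R) :=
  HermSpace {
    herm_module :> lmodType R;
    herm_form :
      {bilinear herm_module -> herm_module -> R | sigma \; *%R & *%R};
    herm_fg : finitely_generated herm_module;
    herm_proj : projective herm_module;
    herm_formC : forall x y : herm_module,
      herm_form x y = sigma (herm_form y x) * u
  }.

Arguments herm_proj [R sigma u] h.
Arguments herm_formC [R sigma u] h x y.

Section OrthogonalSum.
Variables (R : comNzRingType) (sigma : involutive_rmorphism R) (u : R).

Lemma finitely_generated_prod (P Q : lmodType R) :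
  finitely_generated P -> finitely_generated Q ->
  finitely_generated (P * Q)%type.
Proof.
move=> [m [e eP]] [n [f fQ]].
exists (m + n)%N, (fun k => match split k with
                           | inl i => (e i, 0) | inr j => (0, f j) end).
move=> [x y]; have [a ->] := eP x; have [b ->] := fQ y.
exists (fun k => match split k with inl i => a i | inr j => b j end).
rewrite big_split_ord /=.
rewrite (eq_bigr (fun i => a i *: (e i, 0))); last first.
  by move=> i _; rewrite (unsplitK (inl i)).
rewrite [X in _ + X](eq_bigr (fun j => b j *: (0, f j))); last first.
  by move=> j _; rewrite (unsplitK (inr j)).
apply: injective_projections; rewrite /= !raddf_sum /=.
  by rewrite [X in _ + X]big1 ?addr0 // => i _; rewrite scaler0.
by rewrite [X in X + _]big1 ?add0r // => i _; rewrite scaler0.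
Qed.

Lemma projective_prod (P Q : lmodType R) :
  projective P -> projective Q -> projective (P * Q)%type.
Proof.
move=> projP projQ M N p f p_onto.
pose inP (x : P) : (P * Q)%type := (x, 0).
pose inQ (y : Q) : (P * Q)%type := (0, y).
have inPl : linear inP by move=> a x y; congr pair; rewrite /= scaler0 addr0.
have inQl : linear inQ by move=> a x y; congr pair; rewrite /= scaler0 addr0.
pose iP := GRing.isLinear.Build R P (P * Q)%type *:%R inP inPl.
pose iQ := GRing.isLinear.Build R Q (P * Q)%type *:%R inQ inQl.
pose inPL : {linear P -> (P * Q)%type} := HB.pack inP iP.
pose inQL : {linear Q -> (P * Q)%type} := HB.pack inQ iQ.
have [gP gPE] := projP M N p (f \o inPL) p_onto.
have [gQ gQE] := projQ M N p (f \o inQL) p_onto.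
exists ((gP \o fst) \+ (gQ \o snd)) => -[x y].
rewrite /= linearD gPE gQE /= -linearD; congr (f _).
by congr pair; rewrite /= ?addr0 ?add0r.
Qed.

Variables P Q : herm_space sigma u.

Definition orth_form (x y : (P * Q)%type) : R :=
  herm_form P x.1 y.1 + herm_form Q x.2 y.2.

Lemma orth_form_bilinear :
  bilinear_for (sigma \; *%R : R -> R -> R) *%R orth_form.
Proof.
split=> [y a x x' | x a y y']; rewrite /orth_form /=.
  by rewrite !linearPl /= mulrDr addrACA.
by rewrite !linearPr mulrDr addrACA.
Qed.

HB.instance Definition _ :=
  bilinear_isBilinear.Build R (P * Q)%type (P * Q)%type R
    (sigma \; *%R) *%R orth_form orth_form_bilinear.

Lemma orth_formC (x y : (P * Q)%type) :
  orth_form x y = sigma (orth_form y x) * u.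
Proof.
by rewrite /orth_form rmorphD mulrDl -herm_formC -herm_formC.
Qed.

Definition orth_sum : herm_space sigma u :=
  @HermSpace R sigma u (P * Q)%type orth_form
    (finitely_generated_prod (herm_fg P) (herm_fg Q))
    (projective_prod (herm_proj P) (herm_proj Q)) orth_formC.

Definition isometric : Prop :=
  exists psi : {linear P -> Q}, bijective psi /\
    forall x y : P, herm_form Q (psi x) (psi y) = herm_form P x y.

End OrthogonalSum.

(* Main.v *)
Require Import Defs.
From HB Require Import structures.
From mathcomp Require Import all_boot all_algebra.
From mathcomp Require Import fingroup perm ring.

Set Implicit Arguments.
Unset Strict Implicit.
Unset Printing Implicit Defensive.

Import GRing.Theory.
Local Open Scope ring_scope.

(** The hypothesis on [u] yields [t] with [t + sigma t = 1]: if
    [v = r + sigma r * u] is a unit, then [sigma v * u = v], and [t = r / v]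
    works.  This condition no longer mentions [u], so it survives when a form
    is divided by a common divisor of its values, which changes [u].

    The engine is [isom_feedback].  Let [f] be an isometry from [P + Q] to
    [P + Q'], with [A] the block [P -> P] of [f], and let [U] be an isometry of
    [P].  If [U - A] is invertible, every [q] in [Q] determines a unique [x] in
    [P] such that [f (x, q) = (U x, q')] for some [q'].  As [U] preserves the
    form of [P], comparing values on both sides shows that [q |-> q'] preserves
    the forms of [Q] and [Q'].  If the inverse of [f] is subject to the
    symmetric condition, the map is bijective.

    Cancellation of [P] follows from cancellation of any form that retracts
    onto it, since extending an isometry by the identity on the kernel of the
    retraction gives an isometry of the larger modules
    ([cancellable_retract]).  So one may replace the projective module [P] by a
    free module of which it is a summand.  A form on a free module is
    given by a Gram matrix, written [a *: C] where [a] is a greatest common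
    divisor of the entries, so that [C] has an entry equal to [1]; here
    [sigma a] is a unit multiple of [a], because an automorphism of order two
    of a totally ordered set is trivial, and [C] is hermitian for another
    [u].  A Schur complement splits off a pivot, [1] by [1] or [2] by [2], that
    is invertible up to the factor [a], and induction on the size concludes.

    It remains to cancel the pivots.  For [a *: H] with [H] invertible, the
    corner of the inverse isometry is the adjoint of [A], so only [U - A]
    matters ([cancellable_modular]).  In rank one, [U] is [1] or a norm one
    element not congruent to [1] modulo the maximal ideal, such as
    [- sigma t / t].  A [2] by [2] pivot is required only when [-1] is the
    residue of [u] and [2] is a unit; there [H] is alternating modulo the
    maximal ideal, and one of [1], [-1], two transvections and their product
    is a suitable [U] ([cancellable_plane]).  A pivot [0] has unrelated
    corners, but then any functional on [Q'] may be used to adjust [f]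
    ([cancellable_zero]). *)

(** * Cancellable forms *)

Section Cancellation.
Variable R : comUnitRingType.

Definition orth (M N : lmodType R) (h : M -> M -> R) (g : N -> N -> R)
  (x y : (M * N)%type) : R := h x.1 y.1 + g x.2 y.2.

Definition isom (M N : lmodType R) (h : M -> M -> R) (g : N -> N -> R) : Prop :=
  exists psi : {linear M -> N}, bijective psi /\
    forall x y, g (psi x) (psi y) = h x y.

(** A weak form of biadditivity, stable under [orth], that makes the two summands
    of [orth] orthogonal. *)
Definition pointed (M : lmodType R) (h : M -> M -> R) : Prop :=
  (forall x, h x 0 = 0) /\ (forall y, h 0 y = 0).

Definition cancellable (P : lmodType R) (h : P -> P -> R) : Prop :=
  forall (Q Q' : lmodType R) (g : Q -> Q -> R) (g' : Q' -> Q' -> R),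
    pointed g -> pointed g' -> isom (orth h g) (orth h g') -> isom g g'.

Lemma linear_pack (M N : lmodType R) (f : M -> N) :
  linear f -> exists F : {linear M -> N}, forall x, F x = f x.
Proof.
move=> flin; pose fL := GRing.isLinear.Build R M N *:%R f flin.
pose F : {linear M -> N} := HB.pack f fL.
by exists F.
Qed.

Lemma isomI (M N : lmodType R) (h : M -> M -> R) (g : N -> N -> R)
    (f : M -> N) (f' : N -> M) :
    linear f -> cancel f f' -> cancel f' f ->
    (forall x y, g (f x) (f y) = h x y) -> isom h g.
Proof.
move=> flin fK f'K fE; have [F FE] := linear_pack flin.
exists F; split=> [|x y]; last by rewrite !FE fE.
by exists f' => x; rewrite FE.
Qed.

Lemma isomE (M N : lmodType R) (h : M -> M -> R) (g : N -> N -> R) :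
  isom h g -> exists (f : {linear M -> N}) (f' : {linear N -> M}),
    [/\ cancel f f', cancel f' f & forall x y, g (f x) (f y) = h x y].
Proof.
case=> f [[f' fK f'K] fE].
have [F' F'E] := linear_pack (can2_linear fK f'K).
by exists f, F'; split=> // x; rewrite F'E.
Qed.

(** An isometry [f] between [P + Q] and [P + Q'] lifts to [M + Q] and [M + Q'] by
    acting as [f] on the image of [s] and as the identity on the kernel of [p],
    which lies in the radical of [hM]. *)
Lemma cancellable_retract (M P : lmodType R) (hM : M -> M -> R)
    (hP : P -> P -> R) (p : {linear M -> P}) (s : {linear P -> M}) :
    cancel s p -> (forall x y, hM x y = hP (p x) (p y)) ->
  cancellable hM -> cancellable hP.
Proof.
move=> sK hME canM Q Q' g g' g0 g'0 /isomE[f [f' [fK f'K fE]]].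
apply: (canM _ _ _ _ g0 g'0).
pose lift N N' (k : (P * N)%type -> (P * N')%type) (x : (M * N)%type) :=
  (s (k (p x.1, x.2)).1 + (x.1 - s (p x.1)), (k (p x.1, x.2)).2) : (M * N')%type.
have pE N N' (k : (P * N)%type -> (P * N')%type) x :
    p (lift N N' k x).1 = (k (p x.1, x.2)).1.
  by rewrite /= linearD linearB /= !sK subrr addr0.
have liftK N N' (k : (P * N)%type -> (P * N')%type) k' :
    cancel k k' -> cancel (lift N N' k) (lift N' N k').
  move=> kK [x y]; rewrite /lift /= linearD linearB /= !sK subrr addr0.
  rewrite -surjective_pairing kK /=; congr pair.
  by rewrite addrC [s (k _).1 + _]addrC addrK subrK.
apply: (@isomI _ _ _ _ (lift _ _ f) (lift _ _ f')); try exact: liftK.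
  move=> a x y; rewrite /lift.
  have -> : (p (a *: x + y).1, (a *: x + y).2) =
            a *: (p x.1, x.2) + (p y.1, y.2) :> (P * Q)%type.
    by congr pair; rewrite /= linearP.
  rewrite linearP; congr pair => /=.
  rewrite !linearP /= !scalerDr ?scalerN.
  by rewrite [X in _ + _ + X = _]addrACA [LHS]addrACA.
by move=> x y; rewrite /orth !hME !pE; apply: etrans (fE _ _) _.
Qed.

Lemma cancellable_orth (M N : lmodType R) (h : M -> M -> R) (g : N -> N -> R) :
  pointed g -> cancellable h -> cancellable g -> cancellable (orth h g).
Proof.
move=> [gx0 g0y] canh cang Q Q' k k' [kx0 k0y] [k'x0 k'0y].
case/isomE=> f [f' [fK f'K fE]].
apply: cang => //; apply: canh.
- by split=> [x|y]; rewrite /orth /= ?gx0 ?g0y ?kx0 ?k0y addr0.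
- by split=> [x|y]; rewrite /orth /= ?gx0 ?g0y ?k'x0 ?k'0y addr0.
pose re (L : lmodType R) (x : (M * (N * L))%type) : (M * N * L)%type :=
  ((x.1, x.2.1), x.2.2).
pose re' (L : lmodType R) (x : (M * N * L)%type) : (M * (N * L))%type :=
  (x.1.1, (x.1.2, x.2)).
apply: (@isomI _ _ _ _ (fun x => re' _ (f (re _ x)))
  (fun x => re' _ (f' (re _ x)))).
- move=> a x y.
  have -> : re _ (a *: x + y) = a *: re _ x + re _ y by [].
  by rewrite linearP.
- by move=> [x [y z]]; rewrite /re /re' /= -!surjective_pairing fK.
- by move=> [x [y z]]; rewrite /re /re' /= -!surjective_pairing f'K.
by move=> x y; rewrite /orth /= !addrA; apply: etrans (fE _ _) _.
Qed.

Lemma corner_mx k (Q Q' : lmodType R)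
    (f : {linear ('rV[R]_k * Q)%type -> ('rV[R]_k * Q')%type}) :
  exists A : 'M[R]_k, forall x, (f (x, 0)).1 = x *m A.
Proof.
pose c (x : 'rV[R]_k) : 'rV[R]_k := (f (x, 0)).1.
have clin : linear c.
  move=> a x y; rewrite /c.
  have -> : (a *: x + y, 0) = a *: (x, 0) + (y, 0) :> ('rV[R]_k * Q)%type.
    by congr pair; rewrite /= scaler0 addr0.
  by rewrite linearP.
have [C CE] := linear_pack clin.
by exists (lin1_mx C) => x; rewrite mul_rV_lin1 CE.
Qed.

(** Closing the loop: [X q] is the solution [x] of [f (x, q) = (x *m U, q')],
    and [q |-> q'] is the isometry sought.  The invertibility of [1 - U *m A']
    gives unique solutions to the same equation read backwards,
    [f' (x *m U, q') = (x, q)], which provides the inverse. *)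
Lemma isom_feedback k (h : 'rV[R]_k -> 'rV[R]_k -> R) (Q Q' : lmodType R)
    (g : Q -> Q -> R) (g' : Q' -> Q' -> R)
    (f : {linear ('rV[R]_k * Q)%type -> ('rV[R]_k * Q')%type})
    (f' : {linear ('rV[R]_k * Q')%type -> ('rV[R]_k * Q)%type})
    (A A' U : 'M[R]_k) :
    cancel f f' -> cancel f' f ->
    (forall x y, orth h g' (f x) (f y) = orth h g x y) ->
    (forall x, (f (x, 0)).1 = x *m A) -> (forall x, (f' (x, 0)).1 = x *m A') ->
    (forall x y, h (x *m U) (y *m U) = h x y) ->
    U - A \in unitmx -> 1%:M - U *m A' \in unitmx ->
  isom g g'.
Proof.
move=> fK f'K fE AE A'E UE UA UA'.
pose X q := (f (0, q)).1 *m invmx (U - A).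
pose X' q := (f' (0, q)).1 *m invmx (1%:M - U *m A').
have split_pair (Q0 : lmodType R) x (q : Q0) :
    (x, q) = (x, 0) + (0, q) :> ('rV[R]_k * Q0)%type.
  by congr pair; rewrite /= ?addr0 ?add0r.
have fX q : f (X q, q) = (X q *m U, (f (X q, q)).2).
  rewrite [LHS]surjective_pairing; congr pair.
  rewrite split_pair linearD /= AE.
  have <- : X q *m (U - A) = (f (0, q)).1 by rewrite /X mulmxKV.
  by rewrite mulmxBr addrC subrK.
have f'X' q : f' (X' q *m U, q) = (X' q, (f' (X' q *m U, q)).2).
  rewrite [LHS]surjective_pairing; congr pair.
  rewrite split_pair linearD /= A'E.
  have <- : X' q *m (1%:M - U *m A') = (f' (0, q)).1 by rewrite /X' mulmxKV.
  by rewrite mulmxBr mulmx1 mulmxA addrC subrK.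
have X_uniq x q q' : f (x, q) = (x *m U, q') -> x = X q.
  move=> fx; rewrite /X -[LHS](mulmxK UA); congr (_ *m _).
  rewrite mulmxBr -AE -[x *m U](congr1 fst fx) (split_pair _ x q).
  by rewrite linearD addrC addKr.
have X'_uniq x q q' : f' (x *m U, q) = (x, q') -> x = X' q.
  move=> fx; rewrite /X' -[LHS](mulmxK UA'); congr (_ *m _).
  rewrite mulmxBr mulmx1 mulmxA -A'E.
  rewrite -[x in x - _](congr1 fst fx) (split_pair _ _ q).
  by rewrite linearD addrC addKr.
apply: (@isomI _ _ _ _ (fun q => (f (X q, q)).2)
  (fun q => (f' (X' q *m U, q)).2)).
- move=> a q q1.
  have XP : X (a *: q + q1) = a *: X q + X q1.
    rewrite /X scalemxAl -mulmxDl; congr (_ *m _).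
    rewrite -[RHS]/((a *: f (0, q) + f (0, q1)).1) -linearP; congr (fst (f _)).
    by congr pair; rewrite /= scaler0 addr0.
  rewrite -[RHS]/((a *: f (X q, q) + f (X q1, q1)).2) -linearP.
  by rewrite XP.
- move=> q; have := congr1 f' (fX q); rewrite fK => /esym f'q.
  by rewrite -(X'_uniq _ _ _ f'q) f'q.
- move=> q; have := congr1 f (f'X' q); rewrite f'K => /esym fq.
  by rewrite -(X_uniq _ _ _ fq) fq.
move=> q q1; have := fE (X q, q) (X q1, q1).
by rewrite fX [f (X q1, _)]fX /orth /= UE => /addrI.
Qed.

End Cancellation.

(** * Units of a valuation ring with involution *)

Section Valuation.
Variables (R : idomainType) (sigma : involutive_rmorphism R).
Hypothesis hR : valuation_ring R.

Lemma unit_add (x y : R) :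
  x + y \is a GRing.unit -> (x \is a GRing.unit) || (y \is a GRing.unit).
Proof.
case: (hR x y) => [[c ->]|[c ->]].
  by rewrite -{1}[x]mul1r -mulrDl unitrM => /andP[_ ->].
by rewrite -{2}[y]mul1r -mulrDl unitrM => /andP[_ ->]; rewrite orbT.
Qed.

Lemma unit_addl (x y : R) :
  y \isn't a GRing.unit -> (x + y \is a GRing.unit) = (x \is a GRing.unit).
Proof.
move=> yN; apply/idP/idP => [/unit_add|xU]; first by rewrite (negPf yN) orbF.
have /unit_add: (x + y) + - y \is a GRing.unit by rewrite addrK.
by rewrite unitrN (negPf yN) orbF.
Qed.

Lemma unit_addr (x y : R) :
  x \isn't a GRing.unit -> (x + y \is a GRing.unit) = (y \is a GRing.unit).
Proof. by rewrite addrC; exact: unit_addl. Qed.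

Let sigmaK : involutive sigma := rmorphK sigma.

Lemma sigma_unit (x : R) :
  (sigma x \is a GRing.unit) = (x \is a GRing.unit).
Proof.
apply/idP/idP => [sxU|]; last exact: rmorph_unit.
by rewrite -[x]sigmaK; apply: rmorph_unit.
Qed.

(** Either of [a] and [sigma a] divides the other; if [a = c * sigma a], applying
    the involution gives [sigma a = sigma c * a]. *)
Lemma sigma_associate (a : R) : a != 0 -> exists v, sigma a = v * a.
Proof.
move=> a0; case: (hR a (sigma a)) => [//|[c aE]].
by exists (sigma c); rewrite {1}aE rmorphM /= sigmaK.
Qed.

Lemma common_divisor (I : finType) (f : I -> R) (i0 : I) :
  exists i, forall j, exists c, f j = c * f i.
Proof.
suff [i iP] : exists i, forall j, j \in enum I -> exists c, f j = c * f i.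
  by exists i => j; apply: iP; rewrite mem_enum.
elim: (enum I) => [|k s [i iP]]; first by exists i0.
case: (hR (f k) (f i)) => [[c fi]|[c fk]].
  exists k => j /[!inE] /predU1P[->|/iP[d ->]]; first by exists 1; rewrite mul1r.
  by exists (d * c); rewrite fi mulrA.
by exists i => j /[!inE] /predU1P[->|/iP//]; exists c.
Qed.

Variable t : R.
Hypothesis tD : t + sigma t = 1.

Lemma trace_unit : t \is a GRing.unit.
Proof.
have /unit_add : t + sigma t \is a GRing.unit by rewrite tD unitr1.
by rewrite sigma_unit orbb.
Qed.

(** [1 - z] is [t^-1] for [z = - sigma t / t]. *)
Lemma norm_one_unit :
  exists z, [/\ sigma z * z = 1, z \is a GRing.unit & 1 - z \is a GRing.unit].
Proof.
have tU := trace_unit; have stU : sigma t \is a GRing.unit by rewrite sigma_unit.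
exists (- sigma t / t); split.
- rewrite mulNr rmorphN rmorphM /= rmorphV //= sigmaK mulrNN.
  by rewrite mulrA divrK ?mulrV.
- by rewrite unitrM unitrN unitrV tU stU.
by rewrite mulNr opprK -{1}[1](mulrV tU) -mulrDl tD mul1r unitrV.
Qed.

(** The norm one elements [1] and [z] of [norm_one_unit] have distinct residues,
    so they are not both inverse to [a] modulo the maximal ideal. *)
Lemma avoid_unit (a : R) : exists2 z, sigma z * z = 1 &
  z \is a GRing.unit /\ 1 - z * a \is a GRing.unit.
Proof.
have [aU|aN] := boolP (1 - a \is a GRing.unit).
  by exists 1; rewrite ?rmorph1 ?mulr1 ?unitr1 ?mul1r.
have [z [zn zU z1]] := norm_one_unit; exists z => //; split => //.
have aU : a \is a GRing.unit.
  have := unitr1 R; rewrite -[X in X \is a _](subrK a) addrC => /unit_add.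
  by rewrite (negPf aN) orbF.
have -> : 1 - z * a = (1 - a) + (1 - z) * a by ring.
by rewrite unit_addr // unitrM z1 aU.
Qed.

(** * Gram matrices *)

Definition gram_form n (G : 'M[R]_n) (x y : 'rV[R]_n) : R :=
  (map_mx sigma x *m G *m y^T) 0 0.

Lemma gram_delta n (G : 'M[R]_n) i j :
  gram_form G (delta_mx 0 i) (delta_mx 0 j) = G i j.
Proof.
by rewrite /gram_form map_delta_mx trmx_delta -rowE -colE !mxE.
Qed.

Lemma gram_pointed n (G : 'M[R]_n) : pointed (gram_form G).
Proof.
split=> x; rewrite /gram_form; first by rewrite trmx0 mulmx0 mxE.
by rewrite map_mx0 !mul0mx mxE.
Qed.

Lemma gram_formM n m (G : 'M[R]_n) (B C : 'M[R]_(m, n)) x y :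
  gram_form G (x *m B) (y *m C) = gram_form (map_mx sigma B *m G *m C^T) x y.
Proof. by rewrite /gram_form map_mxM trmx_mul !mulmxA. Qed.

Lemma gram_formZ n a (G : 'M[R]_n) x y :
  gram_form (a *: G) x y = a * gram_form G x y.
Proof. by rewrite /gram_form -scalemxAr -scalemxAl mxE. Qed.

Lemma cancellable_congruent n (G B : 'M[R]_n) : B \in unitmx ->
  cancellable (gram_form (map_mx sigma B *m G *m B^T)) ->
  cancellable (gram_form G).
Proof.
move=> BU; apply: (@cancellable_retract _ _ _ _ _
  (mulmxr B) (mulmxr (invmx B))) => [x|x y] /=.
  by rewrite mulmxKV.
by rewrite gram_formM.
Qed.

Lemma cancellable_block m n (G : 'M[R]_m) (H : 'M[R]_n) :
  cancellable (gram_form G) -> cancellable (gram_form H) ->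
  cancellable (gram_form (block_mx G 0 0 H)).
Proof.
move=> canG canH.
have [|p pE] := @linear_pack R ('rV[R]_m * 'rV[R]_n)%type 'rV[R]_(m + n)
    (fun x => row_mx x.1 x.2).
  by move=> a x y; rewrite scale_row_mx add_row_mx.
have [|s sE] := @linear_pack R 'rV[R]_(m + n) ('rV[R]_m * 'rV[R]_n)%type
    (fun x => (lsubmx x, rsubmx x)).
  by move=> a x y; rewrite !linearP.
apply: (@cancellable_retract R _ _ (orth (gram_form G) (gram_form H)) _ p s).
- by move=> x; rewrite sE pE hsubmxK.
- move=> x y; rewrite !pE /orth /gram_form map_row_mx tr_row_mx mul_row_block.
by rewrite !mulmx0 addr0 add0r mul_row_col [RHS]mxE.
exact: cancellable_orth (gram_pointed _) canG canH.
Qed.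

(** For the zero form the corners [a] and [a'] of the isometry and of its inverse
    are independent.  Composing with [(x, q') |-> (x + c q', q')], which is an
    isometry for every linear [c] and leaves [a'] unchanged, replaces [a] by
    [a + s * (1 - a * a')] for any chosen [s].  Either [1 - a * a'] is a unit
    and every corner can be reached, or [a'] is inverse to [a] modulo the
    maximal ideal and the condition on [a'] implies the one on [a]. *)
Lemma cancellable_zero : cancellable (gram_form (0 : 'M[R]_1)).
Proof.
move=> Q Q' g g' _ _ /isomE[f [f' [fK f'K fE]]].
have [A AE] := corner_mx f; have [A' A'E] := corner_mx f'.
have h0 x y : gram_form (0 : 'M[R]_1) x y = 0.
  by rewrite /gram_form mulmx0 mul0mx mxE.
(* This is f' (f (x, 0)) = (x, 0), read in the first component. *)
have fdet x : x *m A *m A' + (f' (0, (f (x, 0)).2)).1 = x.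
  rewrite -AE -A'E -[RHS]/((x, 0 : Q).1) -[in RHS](fK (x, 0)).
  rewrite [f (x, 0) in RHS]surjective_pairing.
  have -> : ((f (x, 0)).1, (f (x, 0)).2) =
     ((f (x, 0)).1, 0) + (0, (f (x, 0)).2) :> ('rV[R]_1 * Q')%type.
    by congr pair; rewrite /= ?addr0 ?add0r.
  by rewrite linearD.
set a := A 0 0; set a' := A' 0 0.
have [w _ [_ wa']] := avoid_unit a'.
have [s sP] : exists s, w - (a + s * (1 - a * a')) \is a GRing.unit.
  have [dU|dN] := boolP (1 - a * a' \is a GRing.unit).
    exists ((w - a - 1) / (1 - a * a')); rewrite divrK //.
    have -> : w - (a + (w - a - 1)) = 1 by ring.
    exact: unitr1.
  exists 0; rewrite mul0r addr0.
  have a'U : a' \is a GRing.unit.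
    have := unitr1 R; rewrite -[X in X \is a _](subrK (a * a')).
    by rewrite unit_addr // unitrM => /andP[].
  suff : (w - a) * a' \is a GRing.unit by rewrite unitrM a'U andbT.
  have -> : (w - a) * a' = - (1 - w * a') + (1 - a * a') by ring.
  by rewrite unit_addl // unitrN.
pose c (z : 'rV[R]_1 * Q') := s *: (f' (0, z.2)).1.
have cP b x y : c (b *: x + y) = b *: c x + c y.
  rewrite /c scalerA mulrC -scalerA -scalerDr; congr (s *: _).
  rewrite -[RHS]/((b *: f' (0, x.2) + f' (0, y.2)).1) -linearP.
  congr (fst (f' _)).
  by congr pair; rewrite /= scaler0 addr0.
have [|e eE] := @linear_pack R ('rV[R]_1 * Q)%type ('rV[R]_1 * Q')%type
    (fun z => ((f z).1 + c (f z), (f z).2)).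
  move=> b x y; rewrite linearP cP; congr pair => /=.
  by rewrite scalerDr addrACA.
have [|e' e'E] := @linear_pack R ('rV[R]_1 * Q')%type ('rV[R]_1 * Q)%type
    (fun z => f' (z.1 - c z, z.2)).
  move=> b x y; apply: etrans (linearP f' _ _ _); congr (f' _).
  rewrite cP; congr pair => /=.
  by rewrite scalerBr opprD addrACA.
apply: (@isom_feedback _ 1 (gram_form 0) _ _ _ _ e e'
  (A + s *: (1%:M - A *m A')) A' w%:M).
- by move=> x; rewrite eE e'E /c /= addrK -surjective_pairing fK.
- by move=> x; rewrite eE e'E f'K /c /= subrK -surjective_pairing.
- by move=> x y; rewrite !eE -fE /orth !h0.
- move=> x; rewrite eE /= AE mulmxDr -scalemxAr; congr (_ + _ *: _).
  by rewrite mulmxBr mulmx1 mulmxA -{2}(fdet x) addrAC subrr add0r.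
- move=> x; rewrite e'E /c /=.
  by rewrite -[(0, 0)]/(0 : ('rV[R]_1 * Q')%type) linear0 scaler0 subr0 A'E.
- by move=> x y; rewrite !h0.
- rewrite [A]mx11_scalar [A']mx11_scalar -scalar_mxM -raddfB scale_scalar_mx.
  by rewrite -raddfD -raddfB unitmxE det_scalar expr1.
rewrite [A']mx11_scalar -scalar_mxM -raddfB unitmxE det_scalar expr1.
exact: wa'.
Qed.

(** Dividing by [a], the corners [A] and [A'] are adjoint for the invertible [H];
    hence the transpose of [1 - U *m A'] is conjugate by [H] to the image of
    [(U - A) *m U^-1] under [sigma], and is invertible with [U - A]. *)
Lemma cancellable_modular k (a : R) (H : 'M[R]_k) :
    a != 0 -> H \in unitmx ->
    (forall A, exists2 U, map_mx sigma U *m H *m U^T = H & U - A \in unitmx) ->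
  cancellable (gram_form (a *: H)).
Proof.
move=> a0 HU flex Q Q' g g' [_ g0x] [g'x0 _] /isomE[f [f' [fK f'K fE]]].
have [A AE] := corner_mx f; have [A' A'E] := corner_mx f'.
have [U UE UA] := flex A.
have aHA : map_mx sigma A *m H = H *m A'^T.
  apply/matrixP => i j; apply: (mulfI a0).
  have := fE (delta_mx 0 i, 0) (f' (delta_mx 0 j, 0)).
  rewrite f'K /orth AE A'E /= g0x g'x0 !addr0 !gram_formZ.
  rewrite -[X in gram_form H _ X]mulmx1 -[X in _ = _ * gram_form H X _]mulmx1.
  by rewrite !gram_formM map_mx1 trmx1 mulmx1 mul1mx !gram_delta.
apply: (isom_feedback fK f'K fE AE A'E _ UA) => [x y|].
  by rewrite gram_formM -scalemxAr -scalemxAl UE.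
suff HU' : H *m (1%:M - U *m A')^T \in unitmx.
  by rewrite unitmx_mul HU unitmx_tr in HU'.
have -> : H *m (1%:M - U *m A')^T = map_mx sigma (U - A) *m H *m U^T.
  rewrite map_mxB mulmxBl mulmxBl UE aHA linearB /= trmx1 trmx_mul.
  by rewrite mulmxBr mulmx1 mulmxA.
have sUA : map_mx sigma (U - A) \in unitmx.
  by rewrite unitmxE det_map_mx sigma_unit -unitmxE.
rewrite !unitmx_mul HU sUA.
have : map_mx sigma U *m H *m U^T \in unitmx by rewrite UE.
by rewrite !unitmx_mul => /andP[_ ->].
Qed.

Lemma cancellable_rank1 (a b : R) : a != 0 -> b \is a GRing.unit ->
  cancellable (gram_form (a *: b%:M : 'M[R]_1)).
Proof.
move=> a0 bU; apply: cancellable_modular => // [|A].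
  by rewrite unitmxE det_scalar expr1.
have [z zn [zU zA]] := avoid_unit (A 0 0); exists (sigma z)%:M.
  rewrite map_scalar_mx /= sigmaK tr_scalar_mx -!scalar_mxM; congr (_%:M).
  by rewrite mulrAC [z * _]mulrC zn mul1r.
rewrite [A]mx11_scalar -raddfB unitmxE det_scalar expr1.
have -> : sigma z - A 0 0 = sigma z * (1 - z * A 0 0).
  by rewrite mulrBr mulr1 mulrA zn mul1r.
by rewrite unitrM sigma_unit zU.
Qed.

(** * Planes that are alternating modulo the maximal ideal *)

Definition mx2 (a b c d : R) : 'M[R]_(1 + 1) :=
  block_mx a%:M b%:M c%:M d%:M.

Lemma mx2_eta (A : 'M[R]_(1 + 1)) :
  exists a b c d, A = mx2 a b c d.
Proof.
exists (ulsubmx A 0 0), (ursubmx A 0 0), (dlsubmx A 0 0), (drsubmx A 0 0).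
by rewrite /mx2 -!mx11_scalar submxK.
Qed.

Lemma mx2M a b c d a' b' c' d' : mx2 a b c d *m mx2 a' b' c' d' =
  mx2 (a * a' + b * c') (a * b' + b * d') (c * a' + d * c') (c * b' + d * d').
Proof. by rewrite /mx2 mulmx_block -!scalar_mxM -!raddfD. Qed.

Lemma mx2B a b c d a' b' c' d' : mx2 a b c d - mx2 a' b' c' d' =
  mx2 (a - a') (b - b') (c - c') (d - d').
Proof. by rewrite /mx2 opp_block_mx add_block_mx -!raddfB. Qed.

Lemma map_mx2 a b c d : map_mx sigma (mx2 a b c d) =
  mx2 (sigma a) (sigma b) (sigma c) (sigma d).
Proof. by rewrite /mx2 map_block_mx !map_scalar_mx. Qed.

Lemma tr_mx2 a b c d : (mx2 a b c d)^T = mx2 a c b d.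
Proof. by rewrite /mx2 tr_block_mx !tr_scalar_mx. Qed.

Lemma mx2_unit a b c d :
  a * d - b * c \is a GRing.unit -> mx2 a b c d \in unitmx.
Proof.
move=> dU; suff :
    mx2 a b c d *m ((a * d - b * c)^-1 *: mx2 d (- b) (- c) a) = 1%:M.
  by case/mulmx1_unit.
suff adjE : mx2 a b c d *m mx2 d (- b) (- c) a = (a * d - b * c)%:M.
  by rewrite -scalemxAr adjE scale_scalar_mx mulVr.
rewrite mx2M (@scalar_mx_block R 1 1) /mx2.
by congr block_mx; rewrite -?[RHS](raddf0 scalar_mx); congr _%:M; ring.
Qed.

Lemma nonunitD (x y : R) : x \isn't a GRing.unit -> y \isn't a GRing.unit ->
  x + y \isn't a GRing.unit.
Proof. by move=> xN yN; rewrite unit_addl. Qed.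

Lemma nonunitM (x y : R) : x \isn't a GRing.unit -> x * y \isn't a GRing.unit.
Proof. by rewrite unitrM => /negPf->. Qed.

(** The equation on [c] says that [z |-> z - c * h(e, z) *: e] is an isometry of
    any [u]-hermitian form [h] with [h(e, e) = a].  It amounts to
    [c^-1 + u * sigma c^-1 = a]; [t * a] is a solution [c^-1] but not a unit,
    and adding [1 - u], which solves the homogeneous equation, makes it one. *)
Lemma transvection_coef (u a : R) :
    sigma u * u = 1 -> a = u * sigma a -> a \isn't a GRing.unit ->
    1 - u \is a GRing.unit ->
  exists2 c, c \is a GRing.unit & sigma c + u * c - a * c * sigma c = 0.
Proof.
move=> un ah aN u1; pose e := t * a + (1 - u).
have eU : e \is a GRing.unit by rewrite /e unit_addr // mulrC nonunitM.
have seU : sigma e \is a GRing.unit by rewrite sigma_unit.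
have eE : e + u * sigma e = a.
  rewrite /e rmorphD rmorphM rmorphB rmorph1 /=.
  have -> : t * a + (1 - u) + u * (sigma t * sigma a + (1 - sigma u)) =
    t * a + sigma t * (u * sigma a) + (1 - sigma u * u) by ring.
  by rewrite -ah un subrr addr0 -mulrDl tD mul1r.
exists e^-1; first by rewrite unitrV.
apply: (mulIr seU); apply: (mulIr eU); rewrite !mul0r rmorphV //=.
have -> : ((sigma e)^-1 + u / e - a / e / sigma e) * sigma e * e =
   (sigma e)^-1 * sigma e * e + u * sigma e * (e^-1 * e)
   - a * (e^-1 * e) * ((sigma e)^-1 * sigma e) by ring.
by rewrite !mulVr // mul1r !mulr1 eE subrr.
Qed.

Lemma lincomb2 (e f1 e1 f2 e2 : R) :
  e1 = 0 -> e2 = 0 -> e = f1 * e1 + f2 * e2 -> e = 0.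
Proof. by move=> -> ->; rewrite !mulr0 addr0. Qed.

(** Let [A] be the matrix to be avoided.  If neither [1 - A] nor [-1 - A] is
    invertible, then modulo the maximal ideal [A] has trace [0] and determinant
    [-1].  Passing from [1] to the transvection [T] or [T'] along a basis vector
    changes the determinant of [1 - A] by a unit multiple of an off-diagonal
    entry of [A]; when both these entries vanish modulo the maximal ideal, the
    product [T *m T'] changes it by a unit multiple of the diagonal entry [p],
    which is then a unit. *)
Lemma cancellable_plane (a u x y : R) : a != 0 ->
    sigma u * u = 1 -> x = u * sigma x -> y = u * sigma y ->
    x \isn't a GRing.unit -> y \isn't a GRing.unit ->
    1 + u \isn't a GRing.unit -> 1 - u \is a GRing.unit ->
  cancellable (gram_form (a *: mx2 x 1 u y)).
Proof.
move=> a0 un xh yh xN yN uN uU.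
have uu : u \is a GRing.unit by move: (unitr1 R); rewrite -un unitrM => /andP[].
have U2 : (2%:R : R) \is a GRing.unit.
  have -> : 2%:R = (1 + u) + (1 - u) :> R by ring.
  by rewrite unit_addr.
apply: cancellable_modular => // [|A].
  by apply: mx2_unit; rewrite mul1r unit_addr ?unitrN // nonunitM.
have [c cU cE] := transvection_coef un xh xN uU.
have [d dU dE] := transvection_coef un yh yN uU.
set H := mx2 x 1 u y.
pose T := mx2 (1 - c * x) 0 (- c) 1.
pose T' := mx2 1 (- (d * u)) 0 (1 - d * y).
have un0 : sigma u * u - 1 = 0 by rewrite un subrr.
have xh0 : x - u * sigma x = 0 by rewrite -xh subrr.
have yh0 : y - u * sigma y = 0 by rewrite -yh subrr.
have TH : map_mx sigma T *m H *m T^T = H.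
  rewrite /T /H map_mx2 tr_mx2 !mx2M.
  rewrite !rmorphB !rmorphN !rmorphM !rmorph0 !rmorph1 /=.
  congr mx2; apply/eqP; rewrite -subr_eq0; apply/eqP.
  - by apply: (lincomb2 (f1 := - x * c) (f2 := - x * sigma x) xh0 cE); ring.
  - by apply: (lincomb2 (f1 := - c) (f2 := - sigma x) xh0 cE); ring.
  - by apply: (lincomb2 (f1 := 0) (f2 := - x) xh0 cE); ring.
  by apply: (lincomb2 (f1 := 0) (f2 := - 1) xh0 cE); ring.
have T'H : map_mx sigma T' *m H *m T'^T = H.
  rewrite /T' /H map_mx2 tr_mx2 !mx2M.
  rewrite !rmorphB !rmorphN !rmorphM !rmorph0 !rmorph1 /=.
  congr mx2; apply/eqP; rewrite -subr_eq0; apply/eqP.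
  - by apply: (lincomb2 (f1 := d * u) (f2 := - sigma u * u) un0 dE); ring.
  - by apply: (lincomb2 (f1 := d * y) (f2 := - sigma u * y) un0 dE); ring.
  - by apply: (lincomb2 (f1 := - u * d) (f2 := - u * sigma y) yh0 dE); ring.
  by apply: (lincomb2 (f1 := - y * d) (f2 := - y * sigma y) yh0 dE); ring.
have [p [q [r [s ->]]]] := mx2_eta A.
pose f1 := (1 - p) * (1 - s) - q * r.
pose f2 := (1 + p) * (1 + s) - q * r.
have [f1U|f1N] := boolP (f1 \is a GRing.unit).
  exists (mx2 1 0 0 1).
    by rewrite map_mx2 tr_mx2 !mx2M !rmorph0 !rmorph1; congr mx2; ring.
  rewrite mx2B; apply: mx2_unit; rewrite !sub0r mulrNN; exact: f1U.
have [f2U|f2N] := boolP (f2 \is a GRing.unit).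
  exists (mx2 (- 1) 0 0 (- 1)).
    rewrite map_mx2 tr_mx2 !mx2M !rmorphN !rmorph0 !rmorph1; congr mx2; ring.
  rewrite mx2B; apply: mx2_unit; rewrite !sub0r mulrNN -!opprD mulrNN; exact: f2U.
have [qU|qN] := boolP (q \is a GRing.unit).
  exists T => //; rewrite mx2B; apply: mx2_unit.
  have -> : (1 - c * x - p) * (1 - s) - (0 - q) * (- c - r) =
    - (q * c) + (f1 + x * (- c * (1 - s))) by rewrite /f1; ring.
  by rewrite unit_addl ?unitrN ?unitrM ?qU ?cU // nonunitD // nonunitM.
have [rU|rN] := boolP (r \is a GRing.unit).
  exists T' => //; rewrite mx2B; apply: mx2_unit.
  have -> : (1 - p) * (1 - d * y - s) - (- (d * u) - q) * (0 - r) =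
    - (r * (d * u)) + (f1 + y * (- d * (1 - p))) by rewrite /f1; ring.
  by rewrite unit_addl ?unitrN ?unitrM ?rU ?dU // nonunitD // nonunitM.
have pU : p \is a GRing.unit.
  suff : 2%:R * (1 + p * s) \isn't a GRing.unit.
    rewrite unitrM U2 /= => psN.
    suff : p * s \is a GRing.unit by rewrite unitrM => /andP[].
    have -> : p * s = - 1 + (1 + p * s) by ring.
    by rewrite unit_addl // unitrN unitr1.
  have -> : 2%:R * (1 + p * s) = f1 + f2 + q * (2%:R * r).
    by rewrite /f1 /f2; ring.
  by do !apply: nonunitD => //; apply: nonunitM.
exists (T *m T').
  rewrite map_mxM trmx_mul -!mulmxA [H *m _]mulmxA.
  by rewrite [_ *m (H *m _ *m _)]mulmxA [_ *m (H *m _)]mulmxA T'H !mulmxA TH.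
rewrite /T /T' mx2M mx2B; apply: mx2_unit.
set D := (X in X \is a _).
have -> : D = - (p * (c * (d * u))) + (f1 + (y * (- (1 - p) * d)
   + (x * (- (c * (1 + c * (d * u) - d * y - s) - c * (d * u) * c))
   + (r * (- ((1 - c * x) * (d * u))) + q * (- c))))).
  by rewrite /D /f1; ring.
rewrite unit_addl ?unitrN ?unitrM ?pU ?cU ?dU //.
by do !apply: nonunitD => //; apply: nonunitM.
Qed.

(** * Splitting off a pivot *)

Definition herm_mx (u : R) n (G : 'M[R]_n) : Prop :=
  G = u *: (map_mx sigma G)^T.

Lemma herm_mxE u n (G : 'M[R]_n) i j :
  herm_mx u G -> G i j = u * sigma (G j i).
Proof. by move=> Gh; rewrite {1}Gh !mxE. Qed.

Lemma map_sigmaK m n (G : 'M[R]_(m, n)) : map_mx sigma (map_mx sigma G) = G.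
Proof. by apply/matrixP => i j; rewrite !mxE sigmaK. Qed.

Lemma herm_congruent u n (G B : 'M[R]_n) :
  herm_mx u G -> herm_mx u (map_mx sigma B *m G *m B^T).
Proof.
move=> Gh; rewrite /herm_mx {1}Gh !map_mxM map_sigmaK !trmx_mul -map_trmx trmxK.
by rewrite -scalemxAr -scalemxAl mulmxA map_trmx.
Qed.

(** Row operations by [B] clear the block [c]; the conjugate column operations
    then clear [b], by hermitian symmetry. *)
Lemma cancellable_schur (a u : R) k n (H : 'M[R]_k) (b : 'M[R]_(k, n))
    (c : 'M[R]_(n, k)) (D : 'M[R]_n) :
    H \in unitmx -> herm_mx u (block_mx H b c D) ->
    cancellable (gram_form (a *: H)) ->
    (forall D' : 'M[R]_n, herm_mx u D' -> cancellable (gram_form (a *: D'))) ->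
  cancellable (gram_form (a *: block_mx H b c D)).
Proof.
move=> HU Gh canH canD.
set G := block_mx H b c D in Gh *.
pose Y := c *m invmx H.
pose B : 'M[R]_(k + n) := block_mx 1%:M 0 (- map_mx sigma Y) 1%:M.
have BU : B \in unitmx by rewrite unitmxE det_lblock !det1 mulr1 unitr1.
have sB : map_mx sigma B = block_mx 1%:M 0 (- Y) 1%:M.
  by rewrite map_block_mx map_mxN map_sigmaK !map_mx1 map_mx0.
have G'h := herm_congruent B Gh.
have [b' [D' G'E]] : exists b' D',
    map_mx sigma B *m G *m B^T = block_mx H b' 0 D'.
  rewrite sB tr_block_mx !trmx1 trmx0 !mulmx_block.
  rewrite !mul1mx !mul0mx !mulmx1 !mulmx0 !addr0 !mulNmx mulmxKV // addNr.
  by rewrite !mul0mx add0r; do 2!eexists.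
move: G'h; rewrite G'E => G'h.
have b'0 : b' = 0.
  apply/matrixP => i j; have := herm_mxE (lshift n i) (rshift k j) G'h.
  by rewrite block_mxEur block_mxEdl !mxE rmorph0 mulr0.
have D'h : herm_mx u D'.
  apply/matrixP => i j; have := herm_mxE (rshift k i) (rshift k j) G'h.
  by rewrite !block_mxEdr !mxE.
apply: (cancellable_congruent BU).
rewrite -scalemxAr -scalemxAl G'E b'0 scale_block_mx !scaler0.
exact: cancellable_block canH (canD _ D'h).
Qed.

Lemma cancellable_perm n (s : 'S_n) (G : 'M[R]_n) :
  cancellable (gram_form (\matrix_(i, j) G (s i) (s j))) ->
  cancellable (gram_form G).
Proof.
move=> canG; apply: (@cancellable_congruent _ _ (perm_mx s)).
  exact: unitmx_perm.
rewrite map_perm_mx -row_permE tr_perm_mx -col_permE.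
have -> // : col_perm s (row_perm s G) = \matrix_(i, j) G (s i) (s j).
by apply/matrixP => i j; rewrite !mxE.
Qed.

Lemma herm_perm u n (s : 'S_n) (G : 'M[R]_n) :
  herm_mx u G -> herm_mx u (\matrix_(i, j) G (s i) (s j)).
Proof. by move=> Gh; apply/matrixP => i j; rewrite !mxE (herm_mxE _ _ Gh). Qed.

Lemma cancellable_diag_pivot (a u : R) n (G : 'M[R]_(1 + n)) i :
    (forall D : 'M[R]_n, herm_mx u D -> cancellable (gram_form (a *: D))) ->
    a != 0 -> herm_mx u G -> G i i \is a GRing.unit ->
  cancellable (gram_form (a *: G)).
Proof.
move=> IH a0 Gh GU; pose s : 'S_(1 + n) := tperm (lshift n 0) i.
apply: (@cancellable_perm _ s).
have -> : \matrix_(i, j) (a *: G) (s i) (s j) =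
          a *: \matrix_(i, j) G (s i) (s j).
  by apply/matrixP => k l; rewrite !mxE.
have := herm_perm s Gh; set G' := \matrix_(i, j) _.
rewrite -[G']submxK [ulsubmx G']mx11_scalar.
have -> : ulsubmx G' 0 0 = G i i by rewrite !mxE tpermL.
move=> G'h; apply: cancellable_schur G'h _ IH => //.
  by rewrite unitmxE det_scalar expr1.
exact: cancellable_rank1.
Qed.

Lemma cancellable_plane_pivot (a u : R) n (G : 'M[R]_(1 + 1 + n)) i j :
    (forall D : 'M[R]_n, herm_mx u D -> cancellable (gram_form (a *: D))) ->
    a != 0 -> sigma u * u = 1 -> herm_mx u G -> i != j ->
    G i i \isn't a GRing.unit -> G j j \isn't a GRing.unit -> G i j = 1 ->
    1 + u \isn't a GRing.unit -> 1 - u \is a GRing.unit ->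
  cancellable (gram_form (a *: G)).
Proof.
move=> IH a0 un Gh ij iN jN Gij uN uU.
pose k0 : 'I_(1 + 1 + n) := lshift n (lshift 1 0).
pose k1 : 'I_(1 + 1 + n) := lshift n (rshift 1 0).
pose s : 'S_(1 + 1 + n) := (tperm k1 (tperm k0 i j) * tperm k0 i)%g.
have s1 : s k1 = j by rewrite permM tpermL tpermK.
have s0 : s k0 = i.
  rewrite permM (@tpermD _ k1 _ k0) ?tpermL //.
  by rewrite -(inj_eq (@perm_inj _ (tperm k0 i))) tpermK tpermL eq_sym.
apply: (@cancellable_perm _ s).
have -> : \matrix_(i, j) (a *: G) (s i) (s j) =
          a *: \matrix_(i, j) G (s i) (s j).
  by apply/matrixP => k l; rewrite !mxE.
have := herm_perm s Gh; set G' := \matrix_(i, j) _.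
have Hu : ulsubmx G' = mx2 (G i i) 1 u (G j j).
  rewrite -[ulsubmx G']submxK /mx2; congr block_mx; rewrite [LHS]mx11_scalar !mxE.
  - by rewrite s0.
  - by rewrite s0 s1 Gij.
  - by rewrite s0 s1 (herm_mxE _ _ Gh) Gij rmorph1 mulr1.
  by rewrite s1.
rewrite -[G']submxK Hu => G'h; apply: cancellable_schur G'h _ IH => //.
  apply: mx2_unit; rewrite mul1r unit_addr ?unitrN ?nonunitM //.
  by move: (unitr1 R); rewrite -un unitrM => /andP[].
apply: (@cancellable_plane _ u) => //; exact: herm_mxE Gh.
Qed.

Lemma gram_form_pair n (G : 'M[R]_n) i j s :
  gram_form G (delta_mx 0 i + s *: delta_mx 0 j)
    (delta_mx 0 i + s *: delta_mx 0 j) =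
  G i i + s * G i j + sigma s * G j i + sigma s * s * G j j.
Proof.
rewrite -!(gram_delta G) /gram_form map_mxD map_mxZ !linearD /= !linearZ /=.
rewrite !mulmxDl -!scalemxAl.
move: (_ *m G *m _) (_ *m G *m _) (_ *m G *m _) (_ *m G *m _) => W X Y Z.
by rewrite !mxE; ring.
Qed.

(** If some [s + sigma s * u] is a unit while [C i i] and [C j j] are not, the
    form takes a unit value on the vector [e_i + s e_j], which can replace [e_i]
    as a rank one pivot.  Trying [s = 1] and [s = t] suffices: if both fail,
    then [t * (1 - u)] differs from [- u] by a nonunit, so [1 - u] is a unit and
    [C] has a plane as in [cancellable_plane] as pivot. *)
Lemma cancellable_unit_entry (a u : R) n (C : 'M[R]_n.+1) i j :
    (forall m (D : 'M[R]_m), (m < n.+1)%N -> herm_mx u D ->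
      cancellable (gram_form (a *: D))) ->
    a != 0 -> sigma u * u = 1 -> herm_mx u C -> C i j = 1 ->
  cancellable (gram_form (a *: C)).
Proof.
move=> IH a0 un Ch Cij.
have diag (C' : 'M[R]_n.+1) k : herm_mx u C' -> C' k k \is a GRing.unit ->
    cancellable (gram_form (a *: C')).
  move=> C'h; apply: (cancellable_diag_pivot _ a0 C'h) => D Dh.
  exact: IH Dh.
have [iU|iN] := boolP (C i i \is a GRing.unit); first exact: diag iU.
have [jU|jN] := boolP (C j j \is a GRing.unit); first exact: diag jU.
have ij : i != j.
  by apply: contraNneq iN => ij; rewrite {2}ij Cij unitr1.
have even s : s + sigma s * u \is a GRing.unit ->
    cancellable (gram_form (a *: C)).
  move=> sU; pose B : 'M[R]_n.+1 := 1%:M + s *: delta_mx i j.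
  have BU : B \in unitmx.
    suff /mulmx1_unit[] : B *m (1%:M - s *: delta_mx i j) = 1%:M by [].
    rewrite /B mulmxBr mulmx1 mulmxDl mul1mx -scalemxAl -scalemxAr.
    by rewrite mul_delta_mx_0 1?eq_sym // !scaler0 addr0 addrK.
  apply: (cancellable_congruent BU); rewrite -scalemxAr -scalemxAl.
  apply: (@diag _ i); first exact: herm_congruent.
  rewrite -gram_delta -gram_formM mulmxDr mulmx1 -scalemxAr mul_delta_mx.
  rewrite gram_form_pair Cij mulr1 (herm_mxE j i Ch) Cij rmorph1 mulr1.
  rewrite [_ * C j j]mulrC unit_addl 1?nonunitM //.
  by rewrite -addrA unit_addr.
have [uU|uN] := boolP (1 + u \is a GRing.unit).
  by apply: (even 1); rewrite rmorph1 mul1r.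
have [tU|tN] := boolP (t + sigma t * u \is a GRing.unit); first exact: even tU.
have uU : 1 - u \is a GRing.unit.
  suff : t * (1 - u) \is a GRing.unit by rewrite unitrM => /andP[].
  have -> : t * (1 - u) = - u + (t + (t + sigma t - t) * u).
    by rewrite tD; ring.
  rewrite [t + sigma t]addrC addrK unit_addl // unitrN.
  by move: (unitr1 R); rewrite -un unitrM => /andP[].
case: n => [|n] in IH C i j Ch Cij diag iN jN ij even *.
  by rewrite [i]ord1 [j]ord1 eqxx in ij.
apply: (@cancellable_plane_pivot _ u n C i j) => // D Dh.
exact: IH Dh.
Qed.

(** The scalar [a] and an arbitrary [u] are carried through the induction because
    extracting the common divisor [b] of the entries multiplies [u] by
    [v = sigma b / b]. *)
Lemma cancellable_gram n (a u : R) (G : 'M[R]_n) :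
  sigma u * u = 1 -> herm_mx u G -> cancellable (gram_form (a *: G)).
Proof.
elim/ltn_ind: n a u G => -[|n] IH a u G un Gh.
  rewrite [a *: G]flatmx0 -[0](scale1r (0 : 'M[R]_0)).
  apply: cancellable_modular => [||A]; first exact: oner_neq0.
    by rewrite unitmxE det_mx00 unitr1.
  by exists 0; rewrite ?unitmxE ?det_mx00 ?unitr1 // [LHS]flatmx0.
have [[i j] /= ijP] :=
  common_divisor (fun p : 'I_n.+1 * 'I_n.+1 => G p.1 p.2) (ord0, ord0).
have [c cE] := fin_all_exists ijP.
pose C : 'M[R]_n.+1 := \matrix_(k, l) c (k, l).
set b := G i j in cE.
have GE : G = b *: C by apply/matrixP => k l; rewrite !mxE mulrC (cE (k, l)).
rewrite GE scalerA.
have [ab0|ab0] := eqVneq (a * b) 0.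
  rewrite ab0 scale0r.
  have -> : 0 = block_mx 0 0 0 0 :> 'M[R]_(1 + n) by rewrite block_mx0.
  apply: (@cancellable_block 1 n); first exact: cancellable_zero.
  rewrite -(scaler0 _ 0); apply: (IH _ _ _ u) => //.
  by rewrite /herm_mx map_mx0 trmx0 scaler0.
have b0 : b != 0 by apply: contraNneq ab0 => ->; rewrite mulr0.
have [v vE] := sigma_associate b0.
have vn : sigma v * v = 1.
  by apply: (mulIf b0); rewrite mul1r -mulrA -vE -rmorphM /= -vE sigmaK.
have wn : sigma (u * v) * (u * v) = 1.
  by rewrite rmorphM mulrACA /= un vn mulr1.
have Ch : herm_mx (u * v) C.
  apply/matrixP => k l; apply: (mulfI b0); have := herm_mxE k l Gh.
  rewrite GE !mxE rmorphM /= vE => ->; ring.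
have Cij : C i j = 1.
  by apply: (mulfI b0); rewrite mulr1; move/matrixP/(_ i j): GE; rewrite mxE.
apply: (cancellable_unit_entry _ ab0 wn Ch Cij) => m D mn Dh.
exact: (IH m _ _ (u * v)).
Qed.

End Valuation.

(** * Hermitian spaces *)

Lemma herm_form_pointed (R : idomainType) (sigma : involutive_rmorphism R)
    (u : R) (P : herm_space sigma u) : pointed (herm_form P).
Proof. by split=> x; rewrite ?linear0r ?linear0l. Qed.

(** The matrix [G] collects the values on generators of [P]; projectivity splits
    the surjection [p] defined by these generators. *)
Lemma herm_form_retract (R : idomainType) (sigma : involutive_rmorphism R)
    (u : R) (P : herm_space sigma u) :
  exists n (G : 'M[R]_n) (p : {linear 'rV[R]_n -> P})
      (s : {linear P -> 'rV[R]_n}),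
    [/\ herm_mx sigma u G, cancel s p &
        forall x y, gram_form sigma G x y = herm_form P (p x) (p y)].
Proof.
have [n [e eP]] := herm_fg P.
have [|p pE] := @linear_pack R 'rV[R]_n P (fun x => \sum_i x 0 i *: e i).
  move=> a x y; rewrite scaler_sumr -big_split /=; apply: eq_bigr => i _.
  by rewrite !mxE scalerDl scalerA.
have [y|s sE] := @herm_proj _ _ _ P 'rV[R]_n P p idfun.
  have [a ->] := eP y; exists (\row_i a i); rewrite pE.
  by apply: eq_bigr => i _; rewrite mxE.
exists n, (\matrix_(i, j) herm_form P (e i) (e j)), p, s; split=> // [|x y].
  by apply/matrixP => i j; rewrite !mxE herm_formC mulrC.
rewrite !pE linear_sumr /gram_form mxE; apply: eq_bigr => j _.
rewrite linearZr_LR linear_sumlz !mxE mulrC; congr (_ * _).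
by apply: eq_bigr => i _; rewrite linearZl_LR !mxE.
Qed.

Theorem corollary4p18 (R : idomainType) (sigma : involutive_rmorphism R)
    (u : R) (hR : valuation_ring R) (hu : sigma u * u = 1)
    (hr : exists r : R, r + sigma r * u \is a GRing.unit)
    (P Q Q' : herm_space sigma u)
    (hPQ : isometric (orth_sum P Q) (orth_sum P Q')) :
  isometric Q Q'.
Proof.
have [t tD] : exists t, t + sigma t = 1.
  have [r rU] := hr; set v := r + sigma r * u in rU.
  have svE : sigma v * u = v.
    rewrite /v rmorphD rmorphM /= rmorphK mulrDl -mulrA hu mulr1.
    by rewrite addrC.
  have svU : sigma v \is a GRing.unit by apply: rmorph_unit.
  exists (r / v); rewrite rmorphM rmorphV //=.
  have -> : sigma r / sigma v = sigma r * u / v.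
    by apply: (mulIr rU); rewrite divrK // -{2}svE mulrA divrK.
  by rewrite -mulrDl mulrV.
have [n [G [p [s [Gh sK GE]]]]] := herm_form_retract P.
apply: (cancellable_retract sK GE _ (herm_form_pointed Q) (herm_form_pointed Q')).
  by rewrite -[G]scale1r; exact: (cancellable_gram hR tD hu Gh).
exact: hPQ.
Qed.
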